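(* Let $(\mathbb{F}_1,\mathbb{F}_2)\in\{(\mathbb{R},\mathbb{R}),(\mathbb{C},\mathbb{C}),(\mathbb{C},\mathbb{R})\}$. In the category whose objects are $\mathbb{F}_1$-operator spaces and whose morphisms are completely contractive $\mathbb{F}_2$-linear maps, the only injective object, in the purely categorical sense, is $\{0\}$.
   Context: A complex (resp. real) operator space is a complex (resp. real) linear subspace of $B(H)$ for a complex (resp. real) Hilbert space $H$, with the inherited matrix norms. In a category $\mathsf{C}$, a morphism $f:X\to Y$ is a monomorphism if for every object $W$ and all morphisms $g_1,g_2:W\to X$, $f\circ g_1=f\circ g_2$ implies $g_1=g_2$. An object $Z$ is injective in the purely categorical sense if for all objects $X,Y$, every morphism $f:X\to Z$ and every monomorphism $\iota:X\to Y$ (no isometry condition is imposed), there is a morphism $\tilde f:Y\to Z$ with $\tilde f\circ\iota=f$. *)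

(* Defs.v *)
From HB Require Import structures.
From mathcomp Require Import all_boot all_order all_algebra.
From mathcomp Require Import sesquilinear complex.
From mathcomp Require Import all_classical all_reals all_analysis.

Set Implicit Arguments.
Unset Strict Implicit.
Unset Printing Implicit Defensive.

Import Order.TTheory GRing.Theory Num.Theory.
Import numFieldNormedType.Exports.

Local Open Scope ring_scope.
Local Open Scope classical_set_scope.
Local Open Scope complex_scope.

Record category := Category {
  obj :> Type;
  hom : obj -> obj -> Type;
  idm : forall X, hom X X;
  comp : forall X Y Z, hom Y Z -> hom X Y -> hom X Z;
  comp_idl : forall X Y (f : hom X Y), comp (idm Y) f = f;
  comp_idr : forall X Y (f : hom X Y), comp f (idm X) = f;
  compA : forall W X Y Z (h : hom Y Z) (g : hom X Y) (f : hom W X),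
    comp h (comp g f) = comp (comp h g) f
}.

Definition monomorphism (C : category) (X Y : C) (f : hom X Y) : Prop :=
  forall (W : C) (g1 g2 : hom W X), comp f g1 = comp f g2 -> g1 = g2.

Definition injective_object (C : category) (Z : C) : Prop :=
  forall (X Y : C) (f : hom X Z) (i : hom X Y), monomorphism i ->
    exists f' : hom Y Z, comp f' i = f.

Variant scalars := Real | Complex.

Definition field_of (R : realType) (F : scalars) : numFieldType :=
  match F with Real => R | Complex => R[i] end.

Definition conj_of (R : realType) (F : scalars) :
    {rmorphism field_of R F -> field_of R F} :=
  match F with
  | Real => (idfun : {rmorphism R -> R})
  | Complex => (Num.conj : {rmorphism R[i] -> R[i]})
  end.

Definition re_of (R : realType) (F : scalars) : field_of R F -> R :=
  match F return field_of R F -> R with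
  | Real => fun x => x
  | Complex => @complex.Re R
  end.

(* The pairs (F1, F2): objects are F1-linear, morphisms are F2-linear. *)
Variant scalar_pair : scalars -> scalars -> Set :=
  | RR : scalar_pair Real Real
  | CC : scalar_pair Complex Complex
  | CR : scalar_pair Complex Real.

Definition scalar_incl (R : realType) (F1 F2 : scalars)
    (p : scalar_pair F1 F2) : field_of R F2 -> field_of R F1 :=
  match p in scalar_pair F1 F2 return field_of R F2 -> field_of R F1 with
  | RR => fun a => a
  | CC => fun a => a
  | CR => real_complex R
  end.

(* The library norm on a module over R[i] takes its values in R[i], hence the
   equation below lives in the scalar field. *)
Record hilbert (R : realType) (F : scalars) := Hilbert {
  hilbert_sort :> completeNormedModType (field_of R F);
  inner : {dot hilbert_sort for conj_of R F};
  inner_norm : forall u : hilbert_sort, `|u| ^+ 2 = inner u u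
}.

Section bounded_operators.
Context {K : numFieldType} (U : normedModType K).

Definition is_bounded_operator (T : U -> U) : Prop :=
  linear T /\ exists M : K, forall x, `|T x| <= M * `|x|.

Definition bounded_operators : {pred U -> U} :=
  fun T => `[< is_bounded_operator T >].

Lemma bounded_operators_submod : submod_closed bounded_operators.
Proof.
split.
  apply/asboolP; split; first by move=> a x y /=; rewrite [RHS](_ : _ = a *: 0 + 0) // scaler0 addr0.
  by exists 0 => x; rewrite [0 x](_ : _ = 0) // normr0 mul0r.
move=> a S T /asboolP[linS [M MS]] /asboolP[linT [N NT]].
apply/asboolP; split.
  move=> b x y.
  rewrite [LHS](_ : _ = a *: S (b *: x + y) + T (b *: x + y)) //.
  rewrite [RHS](_ : _ = b *: (a *: S x + T x) + (a *: S y + T y)) //.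
  rewrite (linS b x y) (linT b x y).
  by rewrite !scalerDr !scalerA addrACA (mulrC a b).
exists (`|a| * M + N) => x; rewrite [(_ + T) x](_ : _ = a *: S x + T x) //.
rewrite mulrDl (le_trans (ler_normD _ _))//.
by rewrite lerD// normrZ -mulrA ler_wpM2l.
Qed.

HB.instance Definition _ :=
  GRing.isSubmodClosed.Build K (U -> U) bounded_operators
    bounded_operators_submod.

(* B(U), as a subspace of the vector space U -> U of all functions *)
Record bop := Bop { bop_fun :> U -> U ; _ : bop_fun \in bounded_operators }.

HB.instance Definition _ := [isSub for bop_fun].
HB.instance Definition _ := [Choice of bop by <:].
HB.instance Definition _ := [SubChoice_isSubLmodule of bop by <:].

End bounded_operators.

Record operator_space (R : realType) (F : scalars) := OperatorSpace {
  os_hilbert : hilbert R F;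
  os_subspace : submodClosed (bop os_hilbert)
}.

Section elements.
Context {R : realType} {F : scalars} (X : operator_space R F).

Record os_sort :=
  OsSort { os_val :> bop (os_hilbert X) ; _ : os_val \in os_subspace X }.

HB.instance Definition _ := [isSub for os_val].
HB.instance Definition _ := [Choice of os_sort by <:].
HB.instance Definition _ := [SubChoice_isSubLmodule of os_sort by <:].

End elements.

Coercion os_sort : operator_space >-> Sortclass.

Section matrix_norm.
Context {R : realType} {F : scalars}.

(* The norm of the Hilbert space direct sum H^n; re_of only converts the
   (real, nonnegative) norm of a vector from field_of R F to R. *)
Definition l2norm (H : hilbert R F) n (xi : 'I_n -> H) : R :=
  Num.sqrt (\sum_(i < n) re_of `|xi i| ^+ 2).

Definition opmx_apply (H : hilbert R F) n (A : 'M[bop H]_n)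
    (xi : 'I_n -> H) : 'I_n -> H :=
  fun i => \sum_(j < n) A i j (xi j).

(* The norm of M_n(X) inherited from M_n(B(H)) = B(H^n), i.e. the operator norm
   of the operator matrix A on H^n. The entries of A are bounded, hence so is
   this set and the sup is the genuine supremum. *)
Definition mxnorm (X : operator_space R F) n (A : 'M[X]_n) : R :=
  sup [set l2norm (opmx_apply (map_mx (@os_val R F X) A) xi)
      | xi in [set xi | l2norm xi <= 1]].

End matrix_norm.

Section category_of_operator_spaces.
Context (R : realType) (F1 F2 : scalars) (p : scalar_pair F1 F2).
Implicit Types X Y Z : operator_space R F1.

Definition completely_contractive X Y (f : X -> Y) : Prop :=
  forall n (A : 'M[X]_n), mxnorm (map_mx f A) <= mxnorm A.

Definition linear_over X Y (f : X -> Y) : Prop :=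
  forall (a : field_of R F2) (x y : X),
    f (scalar_incl p a *: x + y) = scalar_incl p a *: f x + f y.

Record os_hom X Y := OsHom {
  os_fun :> X -> Y;
  os_fun_linear : linear_over os_fun;
  os_fun_cc : completely_contractive os_fun
}.

Lemma os_hom_ext X Y (f g : os_hom X Y) : os_fun f = os_fun g -> f = g.
Proof.
case: f g => [f lf cf] [g lg cg] /= fg; subst g.
by rewrite (Prop_irrelevance lf lg) (Prop_irrelevance cf cg).
Qed.

Lemma idfun_linear_over X : linear_over (@idfun X).
Proof. by []. Qed.

Lemma idfun_cc X : completely_contractive (@idfun X).
Proof. by move=> n A; rewrite map_mx_id. Qed.

Definition os_id X : os_hom X X :=
  OsHom (@idfun_linear_over X) (@idfun_cc X).

Lemma comp_linear_over X Y Z (g : os_hom Y Z) (f : os_hom X Y) :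
  linear_over (g \o f).
Proof. by move=> a x y /=; rewrite !os_fun_linear. Qed.

Lemma comp_cc X Y Z (g : os_hom Y Z) (f : os_hom X Y) :
  completely_contractive (g \o f).
Proof.
move=> n A; rewrite map_mx_comp.
exact: le_trans (os_fun_cc g _) (os_fun_cc f _).
Qed.

Definition os_comp X Y Z (g : os_hom Y Z) (f : os_hom X Y) : os_hom X Z :=
  OsHom (comp_linear_over g f) (comp_cc g f).

Definition OpSpaces : category.
Proof.
by refine (@Category (operator_space R F1) os_hom os_id os_comp _ _ _) => *;
  apply: os_hom_ext.
Defined.

End category_of_operator_spaces.

(* Main.v *)
Require Import Defs.
From mathcomp Require Import all_boot all_order all_algebra.
From mathcomp Require Import all_classical all_reals all_analysis.
From mathcomp Require Import complex.

(** A monomorphism need not be isometric: [x |-> x / 2] is one from [Z] to [Z].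
    Extending the identity of an injective [Z] along it gives a complete
    contraction sending [z / 2] to [z], so [||z|| <= ||z|| / 2] and [z = 0]. *)

Import Order.TTheory GRing.Theory Num.Theory.
Import numFieldNormedType.Exports.

Local Open Scope ring_scope.
Local Open Scope classical_set_scope.

Section scaled_sup.
Set Implicit Arguments.
Unset Strict Implicit.
Context {R : realType}.
Implicit Types (E : set R) (c : R).

Lemma has_sup_scale c E : 0 < c -> has_sup E -> has_sup [set c * x | x in E].
Proof.
move=> c0 [[x Ex] [M ubM]]; split; first by exists (c * x), x.
by exists (c * M) => _ [y Ey <-]; rewrite ler_pM2l// ubM.
Qed.

(** No hypothesis on [E] is required: when [E] has no supremum, neither does its scaling, and both
    sides take the default value 0. *)
Lemma sup_scale_le c E : 0 < c -> sup [set c * x | x in E] <= c * sup E.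
Proof.
move=> c0; have [supE|nsupE] := pselect (has_sup E).
  apply: ge_sup; first by have [] := has_sup_scale c0 supE.
  move=> _ [y Ey <-]; rewrite ler_pM2l//.
  by apply: ub_le_sup => //; have [] := supE.
(* If the scaled set had a supremum, scaling back by [c^-1] would give one for [E]. *)
rewrite !sup_out ?mulr0// => supcE; apply: nsupE.
have cV0 : 0 < c^-1 by rewrite invr_gt0.
have -> : E = [set c^-1 * y | y in [set c * x | x in E]].
  rewrite image_comp (_ : _ \o _ = id) ?image_id//.
  by apply/funext => x /=; rewrite mulKf// gt_eqF.
exact: has_sup_scale.
Qed.

Lemma sup_ge0 E : (forall x, E x -> 0 <= x) -> 0 <= sup E.
Proof.
move=> E0; have [supE|nsupE] := pselect (has_sup E); last by rewrite sup_out.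
have [[x Ex] ubE] := supE.
by apply: le_trans (E0 _ Ex) _; exact: ub_le_sup.
Qed.

End scaled_sup.

Section real_part.
Set Implicit Arguments.
Unset Strict Implicit.
Context {R : realType} {F : scalars}.
Implicit Types x y : field_of R F.

Lemma re_ofD x y : re_of (x + y) = re_of x + re_of y.
Proof. by case: F x y => //= -[a b] [c d]. Qed.

Lemma re_of0 : re_of (0 : field_of R F) = 0.
Proof. by case: F. Qed.

Lemma re_of1 : re_of (1 : field_of R F) = 1.
Proof. by case: F. Qed.

(** Over the complex field [re_of] is additive but not multiplicative, so the factor is extracted by
    splitting [x] into two equal halves. *)
Lemma re_of_half x : re_of (2^-1 * x) = 2^-1 * re_of x.
Proof.
have {2}-> : x = 2^-1 * x + 2^-1 * x.
  by rewrite -mulrDl -mulr2n -[_ *+ 2]mulr_natr mulVf ?mul1r ?pnatr_eq0.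
by rewrite re_ofD -mulr2n -[X in _ = _ * X]mulr_natl mulKf// pnatr_eq0.
Qed.

(** Nonnegative complex numbers have zero imaginary part, so only their real parts are compared. *)
Lemma ler_re_of x y : 0 <= x -> 0 <= y -> (re_of x <= re_of y) = (x <= y).
Proof.
case: F x y => //= -[a b] [c d].
by rewrite !lecE/= => /andP[/eqP-> _] /andP[/eqP-> _]; rewrite eqxx.
Qed.

End real_part.

Section matrix_norms.
Set Implicit Arguments.
Unset Strict Implicit.
Context {R : realType} {F : scalars}.

Lemma l2norm_half (H : hilbert R F) n (xi : 'I_n -> H) :
  l2norm (fun i => 2^-1 *: xi i) = 2^-1 * l2norm xi.
Proof.
rewrite /l2norm (eq_bigr (fun i => 2^-1 ^+ 2 * re_of `|xi i| ^+ 2)); last first.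
  move=> i _; rewrite normrZ gtr0_norm ?invr_gt0 ?ltr0n//.
  by rewrite re_of_half exprMn.
rewrite -mulr_sumr sqrtrM ?exprn_even_ge0// sqrtr_sqr gtr0_norm//.
Qed.

Lemma l2norm1 (H : hilbert R F) (xi : 'I_1 -> H) :
  l2norm xi = re_of `|xi ord0|.
Proof.
rewrite /l2norm big_ord1 sqrtr_sqr ger0_norm//.
by rewrite -(@re_of0 R F) ler_re_of.
Qed.

Lemma mxnorm_ge0 (X : operator_space R F) n (A : 'M[X]_n) : 0 <= mxnorm A.
Proof. by apply: sup_ge0 => _ [xi _ <-]; exact: sqrtr_ge0. Qed.

Lemma mxnorm0 (X : operator_space R F) n : mxnorm (0 : 'M[X]_n) = 0.
Proof.
apply/le_anti; rewrite mxnorm_ge0 andbT; apply: ge_sup.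
  (* The supremum runs over a nonempty set because the zero family lies in the unit ball. *)
  apply: image_nonempty; exists (fun=> 0) => /=.
  by rewrite /l2norm big1 ?sqrtr0// => i _; rewrite normr0 re_of0 expr0n.
move=> _ [xi _ <-]; rewrite /l2norm big1 ?sqrtr0// => i _.
rewrite /opmx_apply big1 ?normr0 ?re_of0 ?expr0n// => j _.
by rewrite !mxE.
Qed.

(** Halving the entries of [A] halves each value whose supremum defines [mxnorm A], so scaling of
    suprema applies. *)
Lemma mxnorm_half_le (X : operator_space R F) n (A : 'M[X]_n) :
  mxnorm (map_mx (fun x => 2^-1 *: x) A) <= 2^-1 * mxnorm A.
Proof.
apply: le_trans (sup_scale_le _ _); last by rewrite invr_gt0.
rewrite image_comp le_eqVlt; apply/orP; left; apply/eqP; congr sup.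
apply: eq_imagel => xi _ /=; rewrite -l2norm_half; congr l2norm.
apply/funext => i; rewrite /opmx_apply scaler_sumr; apply: eq_bigr => j _.
by rewrite !mxE.
Qed.

(** On 1 by 1 matrices [mxnorm] is the operator norm. Boundedness of the operator makes the supremum
    a genuine upper bound, so the operator kills all unit vectors and, by homogeneity, every
    vector. *)
Lemma mxnorm1_le0 (X : operator_space R F) (x : X) :
  mxnorm (const_mx x : 'M[X]_1) <= 0 -> x = 0.
Proof.
have /asboolP[linT [M TM]] := valP (os_val x).
set T := val (os_val x) in linT TM.
have TZ a v : T (a *: v) = a *: T v.
  have T0 : T 0 = 0.
    have /esym/eqP := linT 1 0 0.
    by rewrite !scale1r addr0 -subr_eq0 addrK => /eqP.
  by rewrite -[a *: v]addr0 linT T0 addr0.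
have applyE xi :
    l2norm (opmx_apply (map_mx (@os_val R F X) (const_mx x : 'M[X]_1)) xi) =
    re_of `|T (xi ord0)|.
  by rewrite l2norm1 /opmx_apply big_ord1 !mxE.
move=> x_le0.
have T_ball v : `|v| = 1 -> T v = 0.
  move=> v1; apply/eqP; rewrite -normr_le0 -ler_re_of// re_of0.
  apply: le_trans x_le0; apply: ub_le_sup; last first.
    by exists (fun=> v) => /=; rewrite ?applyE// l2norm1 v1 re_of1.
  (* When the Hilbert space is zero, [M] may be negative or non-real, hence the absolute value.
     Since [M * |xi ord0|] dominates a norm, it is nonnegative and equals [|M| * |xi ord0|]. *)
  exists (re_of `|M|) => _ [xi /= xi1 <-]; rewrite applyE ler_re_of//.
  have {}xi1 : `|xi ord0| <= 1.
    by rewrite -ler_re_of// re_of1 -l2norm1.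
  have Txi := TM (xi ord0).
  have /ger0_norm : 0 <= M * `|xi ord0| by exact: le_trans (normr_ge0 _) Txi.
  rewrite normrM normr_id => Mxi; apply: le_trans Txi _.
  by rewrite -Mxi ler_piMr.
apply/val_inj/val_inj/funext => v /=; rewrite -/T [RHS](_ : _ = 0)//.
have [->|v0] := eqVneq v 0; first by rewrite -[0](scale0r 0) TZ !scale0r.
have nv0 : `|v| != 0 by rewrite normr_eq0.
(* Write [v] as its norm times a unit vector. *)
rewrite -[v](scalerKV nv0) TZ T_ball ?scaler0//.
by rewrite normrZ normfV normr_id mulVf.
Qed.

End matrix_norms.

Theorem theorem6p3 (R : realType) (F1 F2 : scalars) (p : scalar_pair F1 F2)
    (Z : operator_space R F1) :
  @injective_object (OpSpaces R p) Z <-> (forall z : Z, z = 0).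
Proof.
split => [injZ z|Z0 X Y f i _].
  have half_lin : @linear_over R F1 F2 p Z Z (fun x => 2^-1 *: x).
    by move=> a x y; rewrite scalerDr !scalerA mulrC.
  have half_cc : @completely_contractive R F1 Z Z (fun x => 2^-1 *: x).
    move=> n A; apply: le_trans (mxnorm_half_le A) _.
    by rewrite ler_piMl ?mxnorm_ge0// invf_le1 ?ler1n.
  pose half : os_hom p Z Z := OsHom half_lin half_cc.
  have half_mono : @monomorphism (OpSpaces R p) Z Z half.
    (* Multiplication by the nonzero scalar [2^-1] is injective, so it can be cancelled
       pointwise. *)
    move=> W g1 g2 /(congr1 (fun h => os_fun h)) g12; apply: os_hom_ext.
    apply/funext => w; apply: (@scalerI _ _ (2^-1 : field_of R F1)).
      by rewrite invr_eq0 pnatr_eq0.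
    exact: (congr1 (@^~ w) g12).
  have [g gE] := injZ Z Z (os_id p Z) half half_mono.
  have {}gE x : g (2^-1 *: x) = x by exact: (congr1 (fun h => os_fun h x) gE).
  apply: mxnorm1_le0.
  (* Complete contractivity of [g] is applied at matrix size 1, to the matrix with entry
     [2^-1 *: z]. *)
  have : mxnorm (const_mx z : 'M[Z]_1) <= 2^-1 * mxnorm (const_mx z : 'M[Z]_1).
    apply: le_trans (mxnorm_half_le _).
    apply: le_trans (os_fun_cc g _).
    by rewrite !map_const_mx gE.
  (* The inequality becomes [(1 - 2^-1) * mxnorm _ <= 0], with a positive first factor. *)
  rewrite -subr_le0 -{1}[mxnorm _]mul1r -mulrBl pmulr_rle0//.
  by rewrite subr_gt0 invf_lt1 ?ltr1n.
(* Conversely, if [Z] is zero, all maps into it agree, so the zero map on [Y] extends [f]. *)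
have zero_lin : @linear_over R F1 F2 p Y Z (fun=> 0).
  by move=> a x y; rewrite scaler0 addr0.
have zero_cc : @completely_contractive R F1 Y Z (fun=> 0).
  move=> n A; rewrite [map_mx _ _](_ : _ = 0) ?mxnorm0 ?mxnorm_ge0//.
  by apply/matrixP => j k; rewrite !mxE.
exists (OsHom zero_lin zero_cc); apply: os_hom_ext; apply/funext => x /=.
by rewrite [RHS]Z0.
Qed.
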